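(* For every integer $k\ge 2$ there exists an integer $M$ such that for every integer $m\ge M$ there are no polynomials $f_1,\dots,f_k\in\mathbb{C}[x]$ such that no $f_i$ is a scalar multiple of $f_j$ for $i\neq j$ and $$f_1(x)^m+\cdots+f_k(x)^m = 0 .$$
   Context: ''Scalar multiple'' means multiple by an element of $\mathbb{C}$. *)

(* Defs.v *)
From mathcomp Require Export all_boot all_order all_algebra.
From mathcomp Require Export complex reals.

(* The complex numbers are [complex R], written R[i], for R : realType
   (a complete archimedean ordered field, i.e. the real numbers). *)

(* The zero polynomial is a scalar multiple of every polynomial. *)
Definition scalar_multiple (K : nzRingType) (f g : {poly K}) : Prop :=
  exists c : K, f = (c *: g)%R.
Arguments scalar_multiple {K} f g.

(* Main.v *)
Require Import Defs.
From mathcomp Require Import all_boot all_order all_algebra complex reals.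
From mathcomp Require Import zify ring.

(* Nonzero, pairwise non-proportional polynomials f_1, ..., f_k have linearly
   independent m-th powers as soon as m >= k^2.  By induction on k, a nontrivial
   relation has only nonzero coefficients and every k-1 of the powers are
   independent; common roots of the f_i can be divided out.  The Wronskian W of
   the powers other than f_j^m is nonzero, does not depend on j up to a nonzero
   constant, and is divisible by the f_i^(m-k+2), i <> j.  At each point some
   f_j does not vanish, so W is divisible by the product of all k of the
   f_i^(m-k+2).  On the other hand, omitting an f_j of maximal degree gives
   deg W <= m * \sum_(i <> j) deg f_i, which forces all f_i to be constant. *)

Set Implicit Arguments.
Unset Strict Implicit.
Unset Printing Implicit Defensive.

Import GRing.Theory Num.Theory.

Local Open Scope ring_scope.

(** * Pairs of polynomials with vanishing Wronskian *)

Lemma coefM_top (R : nzRingType) (p q : {poly R}) (a b : nat) :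
  (size p <= a.+1)%N -> (size q <= b.+1)%N -> (p * q)`_(a + b) = p`_a * q`_b.
Proof.
move=> sp sq; rewrite coefM.
have a_lt : (a < (a + b).+1)%N by rewrite ltnS leq_addr.
rewrite (bigD1 (Ordinal a_lt)) //= addKn big1 ?addr0 // => j /eqP nej.
have [aj | ja] := ltnP a j; first by rewrite nth_default ?mul0r // (leq_trans sp).
rewrite [q`__]nth_default ?mulr0 // (leq_trans sq) // ltn_subRL.
have : (j : nat) <> a by move=> e; apply: nej; apply: val_inj.
lia.
Qed.

Lemma coefXderiv (R : nzRingType) (p : {poly R}) (i : nat) :
  ('X * p^`())`_i = p`_i *+ i.
Proof. by rewrite coefXM coef_deriv; case: i => [|i] /=; rewrite ?mulr0n. Qed.

Lemma size_Xderiv (R : nzRingType) (p : {poly R}) :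
  (size ('X * p^`())%R <= size p)%N.
Proof.
by apply/leq_sizeP => i hi; rewrite coefXderiv nth_default // mul0rn.
Qed.

(** After multiplication by ['X], the top coefficients of the two sides are the product of the
    leading coefficients times deg q and times deg p. Characteristic zero then equates the
    degrees. *)
Lemma size_eq_wronskian0 (K : numFieldType) (p q : {poly K}) :
  p != 0 -> q != 0 -> p * q^`() = p^`() * q -> size p = size q.
Proof.
move=> p0 q0 e; have [ep eq] := (polySpred p0, polySpred q0).
have : (p * ('X * q^`()))`_((size p).-1 + (size q).-1)
     = (('X * p^`()) * q)`_((size p).-1 + (size q).-1).
  by rewrite mulrCA e mulrA.
rewrite !coefM_top -?ep -?eq ?size_Xderiv // !coefXderiv mulrnAl mulrnAr.
rewrite -[p`__]/(lead_coef p) -[q`__]/(lead_coef q) => /mulrIn e1.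
by rewrite ep eq e1 // mulf_neq0 ?lead_coef_eq0.
Qed.

(** Subtract from [q] the multiple of [p] with the same leading coefficient. A nonzero remainder
    satisfies the same identity, hence has the size of [p], yet its coefficient in that degree
    cancels. *)
Lemma wronskian0_scalar_multiple (K : numFieldType) (p q : {poly K}) :
  p != 0 -> p * q^`() = p^`() * q -> scalar_multiple q p.
Proof.
move=> p0 e; have [-> | q0] := eqVneq q 0; first by exists 0; rewrite scale0r.
pose c := lead_coef q / lead_coef p.
exists c; apply/eqP; rewrite -subr_eq0; apply: contraT => r0.
have spq := size_eq_wronskian0 p0 q0 e.
have er : p * (q - c *: p)^`() = p^`() * (q - c *: p).
  by rewrite derivB derivZ !mulrBr e -!scalerAr [p * p^`()]mulrC.
have spr := size_eq_wronskian0 p0 r0 er.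
have /eqP : lead_coef (q - c *: p) = 0.
  rewrite lead_coefE -spr coefB coefZ -[p`__]/(lead_coef p) spq.
  by rewrite -[q`__]/(lead_coef q) divfK ?subrr // lead_coef_eq0.
by rewrite lead_coef_eq0 (negPf r0).
Qed.

(** * Linear independence over the constants and the Wronskian *)

Definition lin_free (K : fieldType) (n : nat) (g : 'I_n -> {poly K}) : Prop :=
  forall c : 'I_n -> K, \sum_i c i *: g i = 0 -> forall i, c i = 0.

(* Eliminating the last coefficient between the relation and its derivative
   leaves a relation among fewer polynomials, which is trivial by induction;
   so the coefficients are constant multiples of the last one. *)
Lemma lin_free_derivn (K : numFieldType) (n : nat) (g a : 'I_n -> {poly K}) :
  lin_free g ->
  (forall j : nat, (j < n)%N -> \sum_i a i * (g i)^`(j) = 0) ->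
  forall i, a i = 0.
Proof.
elim: n g a => [|n IHn] g a g_free a0; first by case.
pose w := widen_ord (leqnSn n).
have wE i : lift ord_max i = w i by exact/val_inj/lift_max.
have gw_free : lin_free (g \o w).
  move=> c c0; pose d i := if unlift ord_max i is Some i' then c i' else 0.
  have dw i : d (w i) = c i.
    by rewrite /d -wE liftK.
  have d0 : \sum_i d i *: g i = 0.
    rewrite big_ord_recr /= /d unlift_none scale0r addr0 -[RHS]c0.
    by apply: eq_bigr => i _; rewrite -/w -/(d (w i)) dw.
  by move=> i; rewrite -dw; apply: g_free.
have [am0 | am0] := eqVneq (a ord_max) 0.
  have aw0 : forall i, (a \o w) i = 0.
    apply: (IHn (g \o w)) => // j jn; have := a0 j (leqW jn).
    by rewrite big_ord_recr /= am0 mul0r addr0.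
  by move=> i; case: (unliftP ord_max i) => [j|] -> //; rewrite wE; apply: aw0.
(* The derivative of relation [j] is this sum plus relation [j.+1]. *)
have a'0 j : (j < n)%N -> \sum_i (a i)^`() * (g i)^`(j) = 0.
  move=> jn; have := congr1 (@deriv K) (a0 j (leqW jn)).
  rewrite deriv0 raddf_sum /=; under eq_bigr do rewrite derivM.
  rewrite big_split /=; under [X in _ + X]eq_bigr do rewrite -derivnS.
  by rewrite a0 ?addr0 // ltnS.
(* The Wronskian of [a ord_max] and [a i]. It vanishes at [ord_max], so the induction hypothesis
   applies to the other indices. *)
pose b i := a ord_max * (a i)^`() - (a ord_max)^`() * a i.
have bw0 : forall i, (b \o w) i = 0.
  apply: (IHn (g \o w)) => // j jn.
  have : a ord_max * (\sum_i (a i)^`() * (g i)^`(j))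
         - (a ord_max)^`() * (\sum_i a i * (g i)^`(j)) = 0.
    by rewrite a'0 // a0 ?leqW // !mulr0 subrr.
  rewrite !mulr_sumr -sumrB big_ord_recr /= => e.
  rewrite -[RHS]e -[LHS]addr0; congr (_ + _); last by ring.
  by apply: eq_bigr => i _; rewrite /b /=; ring.
have b0 i : b i = 0.
  case: (unliftP ord_max i) => [j|] ->; last by rewrite /b mulrC subrr.
  by rewrite wE; apply: bw0.
have /fin_all_exists [c ac] i : exists c, a i = c *: a ord_max.
  by apply: wronskian0_scalar_multiple => //; apply/eqP; rewrite -subr_eq0; apply/eqP/b0.
(* Relation 0 is [a ord_max] times this sum. *)
suff /g_free c0 : \sum_i c i *: g i = 0 by move=> i; rewrite ac c0 scale0r.
have := a0 0 isT; under eq_bigr => i _ do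
  rewrite derivn0 ac -scalerAl scalerAr.
by rewrite -mulr_sumr => /eqP; rewrite mulf_eq0 (negPf am0) => /eqP.
Qed.

Definition wronskian (K : nzRingType) (n : nat) (g : 'I_n -> {poly K}) :
    'M[{poly K}]_n :=
  \matrix_(i, j) (g i)^`(j).

(** A zero determinant yields a nonzero polynomial row vector in the left kernel; its entries
    satisfy the relations of [lin_free_derivn]. *)
Lemma det_wronskian_neq0 (K : numFieldType) (n : nat) (g : 'I_n -> {poly K}) :
  lin_free g -> \det (wronskian g) != 0.
Proof.
move=> g_free; apply/negP => /det0P [v /eqP v0 vg]; apply: v0.
apply/rowP => i; rewrite mxE.
apply: (lin_free_derivn (a := fun i => v 0 i) g_free) => j jn.
have /rowP /(_ (Ordinal jn)) := vg; rewrite !mxE => e.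
by rewrite -[RHS]e; apply: eq_bigr => k _; rewrite mxE.
Qed.

(** * Divisibility, degree and multiplicity bounds *)

Lemma dvdp_det_rows (K : idomainType) (n : nat) (A : 'M[{poly K}]_n)
    (q : 'I_n -> {poly K}) :
  (forall i j, q i %| A i j) -> \prod_i q i %| \det A.
Proof.
move=> qA; apply: (big_ind (fun p => \prod_i q i %| p)) => [|p r|s _].
- exact: dvdp0.
- exact: dvdp_add.
apply: dvdp_mull; elim/big_ind2: _ => [|p1 p2 r1 r2|i _]; first exact: dvdpp.
  exact: dvdp_mul.
exact: qA.
Qed.

(** Each term of the Leibniz expansion takes one entry from every row, so the row bounds add up. *)
Lemma size_det_rows (K : idomainType) (n : nat) (A : 'M[{poly K}]_n)
    (d : 'I_n -> nat) :
  (forall i j, (size (A i j) <= (d i).+1)%N) ->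
  (size (\det A)%R <= (\sum_i d i).+1)%N.
Proof.
move=> dA; apply: (big_ind (fun p : {poly K} => (size p <= (\sum_i d i).+1)%N)) => [|p q sp sq|s _].
- by rewrite size_poly0.
- by rewrite (leq_trans (size_polyD _ _)) // geq_max sp.
rewrite mulr_sign (fun_if (fun p : {poly K} => size p)) size_polyN if_same.
all: elim/big_ind2: _ => [|p x q y sp sq|i _]; rewrite ?size_poly1 //.
all: by rewrite (leq_trans (size_polyMleq _ _)) //; lia.
Qed.

Lemma dvdp_deriv_exp (K : fieldType) (f g : {poly K}) (e : nat) :
  f ^+ e.+1 %| g -> f ^+ e %| g^`().
Proof.
case/dvdpP => q ->; rewrite derivM deriv_exp dvdp_add //.
  by rewrite exprS mulrA dvdp_mulIr.
by rewrite -mulrnAl mulrA dvdp_mulIr.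
Qed.

Lemma dvdp_derivn_exp (K : fieldType) (f g : {poly K}) (e j : nat) :
  f ^+ (e + j) %| g -> f ^+ e %| g^`(j).
Proof.
elim: j e => [|j IHj] e; first by rewrite addn0.
by rewrite addnS -addSn derivnS => /IHj /dvdp_deriv_exp.
Qed.

(** A root of [p] is a root of [q], so a linear factor splits off both until [p] is constant. This
    allows degrees to be compared point by point. *)
Lemma mup_leq_size (K : closedFieldType) (p q : {poly K}) :
  q != 0 -> p != 0 -> (forall x, mup x p <= mup x q)%N -> (size p <= size q)%N.
Proof.
move: {2}(size p) (leqnn (size p)) => n; elim: n p q => [|n IHn] p q sp q0 p0 pq.
  by rewrite (leq_trans sp).
have [sp1 | /closed_rootP [x px]] := boolP (size p == 1%N).
  by rewrite (eqP sp1) lt0n size_poly_eq0.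
have qx : root q x.
  by rewrite root_factor_theorem XsubC_dvd // (leq_trans _ (pq x)) //
       -XsubC_dvd // -root_factor_theorem.
have /factor_theorem [p' ep] := px; have /factor_theorem [q' eq] := qx.
move: p0 q0; rewrite ep eq !mulf_eq0 !negb_or => /andP[p'0 x0] /andP[q'0 _].
rewrite !size_Mmonic ?monicXsubC // size_XsubC !addn2 ltnS /=.
apply: IHn => //.
  by move: sp; rewrite ep size_Mmonic ?monicXsubC // size_XsubC addn2.
by move=> y; have := pq y; rewrite ep eq !mupM // leq_add2r.
Qed.

Lemma dvdp_leq_mup (K : fieldType) (p q : {poly K}) (x : K) :
  p != 0 -> q != 0 -> p %| q -> (mup x p <= mup x q)%N.
Proof. by move=> p0 q0; rewrite mup_geq //; apply: dvdp_trans; rewrite -mup_geq. Qed.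

Lemma size_derivn_leq (R : nzSemiRingType) (p : {poly R}) (j : nat) :
  (size p^`(j) <= size p)%N.
Proof.
elim: j => [//|j IHj]; rewrite derivnS; apply: leq_trans IHj.
by have [-> | /lt_size_deriv/ltnW //] := eqVneq p^`(j) 0; rewrite deriv0.
Qed.

Lemma degree_prod (R : idomainType) (I : finType) (F : I -> {poly R}) :
  (forall i, F i != 0) -> (size (\prod_i F i)%R).-1 = (\sum_i (size (F i)).-1)%N.
Proof.
move=> F0; suff [] : (\prod_i F i != 0) /\
    (size (\prod_i F i)%R).-1 = (\sum_i (size (F i)).-1)%N by [].
apply: (big_rec2 (fun (p : {poly R}) (d : nat) => p != 0 /\ (size p).-1 = d)) => [|i d p _ [p0 <-]].
  by rewrite oner_eq0 size_poly1.
rewrite mulf_neq0 // size_mul // (polySpred p0) (polySpred (F0 i)).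
by rewrite addSn addnS.
Qed.

(** * Relations between powers *)

Lemma dvdp_det_wronskian_lift (K : fieldType) (n : nat)
    (g : 'I_n.+1 -> {poly K}) (c : 'I_n.+1 -> K) (i j : 'I_n.+1) :
  c j != 0 -> \sum_l c l *: g l = 0 ->
  \det (wronskian (g \o lift j)) %| \det (wronskian (g \o lift i)).
Proof.
move=> cj; rewrite (bigD1_ord j) //= => /eqP; rewrite addr_eq0 => /eqP gj.
have /fin_all_exists [P gP] l :
    exists u : 'I_n -> K, g l = \sum_s u s *: g (lift j s).
  case: (unliftP j l) => [s|] ->.
    exists (fun t => (s == t)%:R); rewrite (bigD1 s) //= eqxx scale1r.
    rewrite big1 ?addr0 // => t; rewrite eq_sym => /negPf ->.
    by rewrite scale0r.
  exists (fun s => - (c j)^-1 * c (lift j s)).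
  rewrite -[LHS](scalerK cj) gj scalerN -scaleNr scaler_sumr.
  by under [RHS]eq_bigr do rewrite -scalerA.
(* Expressing each row through those other than [j] is multiplication by a matrix of constants. *)
have -> : wronskian (g \o lift i)
        = (\matrix_(r, s) (P (lift i r) s)%:P) *m wronskian (g \o lift j).
  apply/matrixP => r o; rewrite !mxE /= gP raddf_sum /=.
  by apply: eq_bigr => s _; rewrite !mxE derivnZ mul_polyC.
by rewrite det_mulmx dvdp_mulIr.
Qed.

Lemma power_relation_coprime (K : numClosedFieldType) (n m : nat)
    (f : 'I_n.+2 -> {poly K}) (c : 'I_n.+2 -> K) :
  (n.+2 ^ 2 <= m)%N -> (forall i, f i != 0) -> (forall i, c i != 0) ->
  (forall x, exists j, ~~ root (f j) x) ->
  (forall i, lin_free (fun s => f (lift i s) ^+ m)) ->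
  \sum_i c i *: f i ^+ m = 0 -> forall i, size (f i) = 1%N.
Proof.
move=> nm f0 c0 f_coprime f_free f_rel.
pose g i := f i ^+ m; pose W i := \det (wronskian (g \o lift i)).
have W0 i : W i != 0 by apply/det_wronskian_neq0/f_free.
case: (@arg_maxnP _ ord0 xpredT (fun i => size (f i))) => // i0 _ max_i0.
have deg_i0 j : ((size (f j)).-1 <= (size (f i0)).-1)%N.
  by rewrite -!subn1 leq_sub2r //; apply: max_i0.
have dvdW j : \prod_s f (lift j s) ^+ (m - n) %| W i0.
  apply: (dvdp_trans _ (dvdp_det_wronskian_lift i0 (c0 j) f_rel)).
  apply: dvdp_det_rows => s o; rewrite mxE; apply: dvdp_derivn_exp.
  (* The derivatives have order [o] at most [n], and each costs at most one factor. *)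
  apply: dvdp_exp2l; have := ltn_ord o; lia.
have fe0 i : f i ^+ (m - n) != 0 by rewrite expf_neq0.
have : (size (\prod_i f i ^+ (m - n))%R <= size (W i0))%N.
  apply: mup_leq_size => // [|x].
    by apply/prodf_neq0 => i _.
  (* [f j] has no multiplicity at [x], so only the product without it counts, and [dvdW j] bounds
     that. *)
  have [j jx] := f_coprime x; rewrite (bigD1_ord j) //= mupMr.
    by apply: dvdp_leq_mup => //; apply/prodf_neq0 => s _.
  by apply: contra jx; rewrite /root horner_exp expf_eq0 => /andP[].
have : (size (W i0) <= (\sum_s (size (f (lift i0 s))).-1 * m).+1)%N.
  apply: size_det_rows => s o; rewrite mxE (leq_trans (size_derivn_leq _ _)) //.
  by rewrite -size_exp leqSpred.
move=> sW /leq_trans /(_ sW); rewrite -ltnS -subn_gt0.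
have P0 : \prod_i f i ^+ (m - n) != 0 by apply/prodf_neq0 => i _.
rewrite subn_gt0 ltnS (polySpred P0) ltnS degree_prod //.
under eq_bigr do rewrite size_exp.
rewrite -!big_distrl (bigD1_ord i0) //=.
set d0 := (size (f i0)).-1; set S := (\sum_s _)%N => le1.
have leS : (S <= n.+1 * d0)%N.
  rewrite -[n.+1]card_ord -sum_nat_const; apply: leq_sum => s _.
  exact: deg_i0.
(* [le1] gives (m - n) d0 <= n S <= n (n + 1) d0, while m >= (n + 2)^2 forces m - n > n (n + 1). *)
have d00 : d0 = 0%N by nia.
move=> i; have := deg_i0 i; rewrite -/d0 d00 leqn0 => /eqP di.
by rewrite (polySpred (f0 i)) di.
Qed.

Lemma lin_free_powers (K : numClosedFieldType) (n m : nat)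
    (f : 'I_n -> {poly K}) :
  (n ^ 2 <= m)%N -> (forall i, f i != 0) ->
  (forall i j, i <> j -> ~ scalar_multiple (f i) (f j)) ->
  lin_free (fun i => f i ^+ m).
Proof.
elim: n f => [|n IHn] f nm f0 f_indep c f_rel; first by case.
have f_free (h : 'I_n.+1 -> {poly K}) : (forall i, h i != 0) ->
    (forall i j, i <> j -> ~ scalar_multiple (h i) (h j)) ->
    forall i, lin_free (fun s => h (lift i s) ^+ m).
  move=> h0 h_indep i; apply: IHn => // [|s t st]; first by nia.
  by apply: h_indep => /lift_inj.
(* A zero coefficient leaves a relation among fewer powers, settled by induction. *)
have [/existsP [j /eqP cj] i | /existsPn c0] := boolP [exists j, c j == 0].
  case: (unliftP j i) => [s|] -> //.
  apply: (f_free f f0 f_indep j (fun s => c (lift j s))).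
  by move: f_rel; rewrite (bigD1_ord j) //= cj scale0r add0r.
exfalso; case: n => [|n] in f nm f0 f_indep c f_rel f_free c0 {IHn} *.
  move/eqP: f_rel; rewrite big_ord1 scaler_eq0 expf_eq0 (negPf (c0 _)).
  by rewrite (negPf (f0 _)) andbF.
(* Dividing out a common root lowers the size of every [f i]; that of [f ord0] serves as the
   measure. *)
move: {2}(size (f ord0)) (leqnn (size (f ord0))) => N.
elim: N => [|N IHN] in f f0 f_indep f_rel *.
  by rewrite leqn0 size_poly_eq0 (negPf (f0 _)).
move=> sN.
have f_coprime x : exists j, ~~ root (f j) x.
  apply/existsP; apply: contraT; rewrite negb_exists => /forallP fx.
  have /fin_all_exists [h fh] i : exists h, f i = h * ('X - x%:P).
    by apply/factor_theorem; rewrite -[root _ _]negbK.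
  have x0 : 'X - x%:P != 0 by rewrite polyXsubC_eq0.
  have h0 i : h i != 0.
    by have := f0 i; rewrite fh mulf_eq0 negb_or => /andP[].
  exfalso; apply: (IHN h) => // [i j ij [a ha]||].
  - by apply: (f_indep i j ij); exists a; rewrite !fh ha scalerAl.
  - move/eqP: f_rel; under eq_bigr do rewrite fh exprMn scalerAl.
    by rewrite -mulr_suml mulf_eq0 expf_eq0 (negPf x0) andbF orbF => /eqP.
  - by move: sN; rewrite fh size_Mmonic ?monicXsubC // size_XsubC addn2.
(* All [f i] are nonzero constants, hence proportional. *)
have f1 := power_relation_coprime nm f0 c0 f_coprime (f_free f f0 f_indep) f_rel.
have /size_poly1P [a a0 fa] : size (f ord0) == 1%N by rewrite f1.
have /size_poly1P [b b0 fb] : size (f ord_max) == 1%N by rewrite f1.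
apply: (f_indep ord0 ord_max) => //; exists (a / b).
by rewrite fa fb -mul_polyC -polyCM divfK.
Qed.

Local Close Scope ring_scope.

Theorem theorem4 (R : realType) (k : nat) (hk : 2 <= k) :
  exists M : nat, forall m : nat, M <= m ->
    ~ exists f : 'I_k -> {poly R[i]},
        (forall i j : 'I_k, i <> j -> ~ scalar_multiple (f i) (f j)) /\
        (\sum_(i < k) f i ^+ m = 0)%R.
Proof.
exists (k ^ 2) => m km [f [f_indep f_rel]].
case: k => [|[|k]] // in hk km f f_indep f_rel *.
(* As there are at least two indices, a zero [f i] would be 0 times some other [f j]. *)
have f0 i : (f i != 0)%R.
  pose j : 'I_k.+2 := if i == ord0 then ord_max else ord0.
  have ij : i <> j by rewrite /j; case: (eqVneq i ord0) => [->|/eqP].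
  by apply/eqP => fi; apply: (f_indep i j ij); exists 0%R; rewrite scale0r.
have := lin_free_powers km f0 f_indep (c := fun=> 1%R).
under eq_bigr do rewrite scale1r.
by move=> /(_ f_rel ord0) /eqP; rewrite oner_eq0.
Qed.
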